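(* Every linear $\mathrm{Datalog}^\circ$ program over a $p$-stable commutative semiring converges in $O(pn^3)$ steps, where $n$ is the total number of ground IDB atoms. Precisely: there is an absolute constant $C>0$ such that for all integers $n\ge 1$ and $p\ge 1$, every $p$-stable commutative semiring $(S,+,\cdot,0,1)$, every matrix $A\in S^{n\times n}$ and every vector $b\in S^n$, the map $f:S^n\to S^n$, $f(x)=Ax+b$, satisfies $f^{(q+1)}(\mathbf 0)=f^{(q)}(\mathbf 0)$ for some integer $0\le q\le C\,p\,n^3$.
   Context: A commutative semiring $(S,+,\cdot,0,1)$ has $(S,+,0)$ and $(S,\cdot,1)$ commutative monoids, $\cdot$ distributing over $+$, and $a\cdot 0=0$ for all $a\in S$. For $u\in S$ put $u^{(p)}:=1+u+u^2+\cdots+u^p$. The element $u$ is $p$-stable if $u^{(p)}=u^{(p+1)}$; the semiring is $p$-stable if every $u\in S$ is $p$-stable. A linear $\mathrm{Datalog}^\circ$ program over $S$ with $n$ ground IDB atoms has, once grounded, an immediate consequence operator of the form $f:S^n\to S^n$, $f(x)=Ax+b$, with $A\in S^{n\times n}$ and $b\in S^n$ (matrix operations computed in $S$). Naive evaluation starts at the all-zero vector $\mathbf 0\in S^n$ and repeatedly applies $f$; $f^{(q)}$ denotes the $q$-fold composition of $f$ with itself ($f^{(0)}$ is the identity). The convergence rate (number of steps to converge) is the smallest $q$ with $f^{(q+1)}(\mathbf 0)=f^{(q)}(\mathbf 0)$. *)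

(* Defs.v *)
From HB Require Import structures.
From mathcomp Require Import all_boot all_algebra.

Set Implicit Arguments.
Unset Strict Implicit.
Unset Printing Implicit Defensive.

Import GRing.Theory.
Local Open Scope ring_scope.

(* Semirings are [pz] ("possibly zero"): 0 = 1 is not excluded, and addition
   need not be idempotent, ordered or cancellative. *)

(* u^(p) = 1 + u + ... + u^p, which has p + 1 terms. *)
Definition power_sum (S : pzSemiRingType) (u : S) (p : nat) : S :=
  \sum_(i < p.+1) u ^+ i.

Definition stable_elt (S : pzSemiRingType) (p : nat) (u : S) : Prop :=
  power_sum u p = power_sum u p.+1.

Definition stable_semiring (S : pzSemiRingType) (p : nat) : Prop :=
  forall u : S, stable_elt p u.

(* Immediate consequence operator of a grounded linear program with n ground
   IDB atoms; elements of S^n are column vectors. *)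
Definition linear_ico (S : pzSemiRingType) (n : nat)
    (A : 'M[S]_n) (b : 'cV[S]_n) (x : 'cV[S]_n) : 'cV[S]_n :=
  A *m x + b.

Definition naive_iterate (S : pzSemiRingType) (n : nat)
    (A : 'M[S]_n) (b : 'cV[S]_n) (q : nat) : 'cV[S]_n :=
  iter q (linear_ico A b) 0.

(* Main.v *)
(* The i-th entry of A^k b sums, over the walks of length k from i, the product
   of the edge weights times an entry of b.  Let w be a walk of length greater
   than p n^3 + n^2.  Deleting suitable closed subwalks leaves a walk of length at
   most n^2 with the same endpoints and vertices; the deleted edges form a
   balanced multiset D of more than p n^3 edges, which splits into simple cycles.  If each of these
   cycles had an edge of multiplicity at most p in D, there would be at most
   p n^2 of them, hence at most p n^3 edges.  So some simple cycle c fits p + 1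
   times in D.  The edges of w minus j copies of c, for 1 <= j <= p + 1, still
   form walks: decompose what is left of D into cycles and insert them in the
   short walk.  By p-stability of the weight of c, the summand of w is
   absorbed by those of these shorter walks. *)

Require Import Defs.
From mathcomp Require Import all_boot all_algebra.

Set Implicit Arguments.
Unset Strict Implicit.
Unset Printing Implicit Defensive.

(** * Walks, balanced edge multisets and insertion of cycles *)

Section Walks.
Context {T : eqType}.
Implicit Types (x y : T) (t : seq T) (s c : seq (T * T)).

(** A walk is its start [x] with the list [t] of later vertices, so [size t] is its length. *)
Definition edges x t : seq (T * T) := pairmap pair x t.

(** In-degree equals out-degree at every vertex, with multiplicity. *)
Definition balanced s : bool := perm_eq (unzip1 s) (unzip2 s).

(** The base point [y] is the last entry of [t], so [uniq t] forbids any other repetition; loops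
    count as cycles. *)
Definition simple_cycle c : Prop :=
  exists y t, [/\ c = edges y t, last y t = y, uniq t & t != [::]].

Lemma size_edges x t : size (edges x t) = size t.
Proof. exact: size_pairmap. Qed.

Lemma edges_cat x t1 t2 : edges x (t1 ++ t2) = edges x t1 ++ edges (last x t1) t2.
Proof. exact: pairmap_cat. Qed.

Lemma unzip1_edges x t : unzip1 (edges x t) = belast x t.
Proof. by elim: t x => //= y t IH x; rewrite IH. Qed.

Lemma unzip2_edges x t : unzip2 (edges x t) = t.
Proof. by elim: t x => //= y t IH x; rewrite IH. Qed.

Lemma balanced_closed y t : last y t = y -> balanced (edges y t).
Proof.
move=> yt; rewrite /balanced unzip1_edges unzip2_edges.
by rewrite -(perm_cons y) [y :: t]lastI yt perm_sym perm_rcons perm_refl.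
Qed.

Lemma perm_balanced s1 s2 : perm_eq s1 s2 -> balanced s1 = balanced s2.
Proof.
move=> s12; rewrite /balanced.
by rewrite (permPl (perm_map _ s12)) (permPr (perm_map _ s12)).
Qed.

Lemma balanced_catr s1 s2 : balanced s1 -> balanced (s1 ++ s2) = balanced s2.
Proof.
move=> b1; rewrite /balanced /unzip1 /unzip2 !map_cat.
by rewrite (permPl (perm_cat b1 (perm_refl _))) perm_cat2l.
Qed.

Lemma balanced_simple_cycle c : simple_cycle c -> balanced c.
Proof. by case=> y [t [-> yt _ _]]; apply: balanced_closed. Qed.

Lemma simple_cycle_uniq c : simple_cycle c -> uniq c.
Proof.
by case=> y [t [-> _ ut _]]; apply: (@map_uniq _ _ snd); rewrite -/(unzip2 _) unzip2_edges.
Qed.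

Lemma simple_cycle_neq0 c : simple_cycle c -> 0 < size c.
Proof. by case=> y [t [-> _ _]]; rewrite size_edges; case: t. Qed.

(** The cycle is spliced in where the walk meets its base point. No vertex is lost, so further
    cycles can be inserted. *)
Lemma insert_cycle x t c : simple_cycle c -> {subset unzip1 c <= x :: t} ->
  exists t', [/\ last x t' = last x t, {subset x :: t <= x :: t'}
               & perm_eq (edges x t') (edges x t ++ c)].
Proof.
case=> y [r [-> yr _ r0]]; rewrite unzip1_edges => sub.
have yt : y \in x :: t by apply: sub; case: r r0 {yr} => //= z r _; rewrite mem_head.
case/splitPl: t / yt {sub} => t1 t2 xy.
exists (t1 ++ r ++ t2); split.
- by rewrite !last_cat xy yr.
- move=> z; rewrite !inE !mem_cat.
  by case/or3P=> ->; rewrite ?orbT.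
- by rewrite !edges_cat xy yr -catA perm_cat2l perm_catC.
Qed.

Lemma insert_cycles x t (cs : seq (seq (T * T))) :
  (forall c, c \in cs -> simple_cycle c) ->
  {subset unzip1 (flatten cs) <= x :: t} ->
  exists2 t', last x t' = last x t & perm_eq (edges x t') (edges x t ++ flatten cs).
Proof.
elim: cs t => [|c cs IH] t cyc sub; first by exists t; rewrite ?cats0.
move: sub; rewrite /unzip1 map_cat => sub.
have [|z zc|t1 [l1 s1 p1]] := @insert_cycle x t c.
- by apply: cyc; rewrite mem_head.
- by apply: sub; rewrite mem_cat zc.
have [d dcs|z zcs|t2 l2 p2] := IH t1.
- by apply: cyc; rewrite inE dcs orbT.
- by apply/s1/sub; rewrite mem_cat zcs orbT.
exists t2; first by rewrite l2.
by rewrite /= catA (perm_trans p2) // perm_cat2r.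
Qed.

Lemma count_mem_perm_cat (U : eqType) (s1 s2 : seq U) :
  (forall e, count_mem e s1 <= count_mem e s2) -> exists r, perm_eq s2 (s1 ++ r).
Proof.
move/count_subseqP=> [s sub s1s]; have [r p] := perm_to_subseq sub.
by exists r; rewrite (perm_trans p) // perm_cat2r perm_sym.
Qed.

Lemma size_flatten_nseq (U : Type) k (s : seq U) :
  size (flatten (nseq k s)) = k * size s.
Proof. by rewrite size_flatten /shape map_nseq sumn_nseq mulnC. Qed.

End Walks.

(** * Cycle decomposition and pumping of long walks on a finite vertex set *)

Section FiniteWalks.
Context {T : finType}.
Implicit Types (x y : T) (t : seq T) (s c : seq (T * T)).

Lemma simple_cycle_size c : simple_cycle c -> size c <= #|T|.
Proof.
by case=> y [t [-> _ ut _]]; rewrite size_edges -(card_uniqP ut) max_card.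
Qed.

(* Each vertex entered by [s] is left by [s], so a successor function stays
   inside [s] and its iterates eventually run around a cycle. *)
Lemma balanced_has_cycle s : balanced s -> s != [::] ->
  exists2 c, simple_cycle c & {subset c <= s}.
Proof.
move=> bal s0.
(* The default [x] is taken only off the sources of [s], which the iteration never leaves. *)
pose f x := odflt x [pick y | (x, y) \in s].
have fP x : x \in unzip1 s -> (x, f x) \in s.
  case/mapP=> [[x' y] xys /= ->]; rewrite /f; case: pickP => //= /(_ y).
  by rewrite xys.
have fs x : x \in unzip1 s -> f x \in unzip1 s.
  by move/fP => xs; rewrite (perm_mem bal); apply/mapP; exists (x, f x).
have [x xs] : exists x, x \in unzip1 s.
  by case: s s0 {bal f fP fs} => //= [[x y] s] _; exists x; rewrite mem_head.
have its k : iter k f x \in unzip1 s by elim: k => //= k; apply: fs.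
have /trajectP[i lt_i it_i] := looping_order f x.
set y := iter i f x in it_i.
(* [y] is a repeated iterate: [f y] leads back to [y], so the orbit of [y] closes up. *)
have cyc : fcycle f (orbit f y).
  by rewrite -fconnect_f -{2}it_i -(subnK lt_i) iterD iterS -/y fconnect_iter.
have ys : forall k, iter k f y \in unzip1 s by move=> k; rewrite -iterD.
have : {subset orbit f y <= unzip1 s}.
  by move=> z /trajectP[k _ ->].
have := orbit_uniq f y; have : orbit f y != [::] by rewrite -size_eq0 size_orbit -lt0n order_gt0.
case: (orbit f y) cyc => // z t /= pth _ uz sub.
exists (edges z (rcons t z)).
  exists z, (rcons t z); rewrite last_rcons rcons_uniq; split=> //.
  by case: t {pth uz sub}.
have {}sub : {subset belast z (rcons t z) <= unzip1 s} by rewrite belast_rcons.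
move: (rcons t z) pth sub => r {uz}.
elim: r z => //= a r IH b /andP[/eqP fb pth] sub e.
rewrite inE => /predU1P[-> | ]; last first.
  by apply: IH => // d dr; apply: sub; rewrite inE dr orbT.
by rewrite -fb; apply: fP; apply: sub; rewrite mem_head.
Qed.

Lemma cycle_decomposition s : balanced s ->
  exists2 cs : seq (seq (T * T)),
    forall c, c \in cs -> simple_cycle c & perm_eq s (flatten cs).
Proof.
have [m] := ubnP (size s); elim: m s => // m IH s /ltnSE le_sm bal.
have [->|s0] := eqVneq s [::]; first by exists [::].
have [c cyc sub] := balanced_has_cycle bal s0.
(* The edges of [c] are distinct, so inclusion as sets is inclusion as multisets. *)
have [e|r pr] := @count_mem_perm_cat _ c s.
  rewrite (count_uniq_mem _ (simple_cycle_uniq cyc)); case: (boolP (e \in c)) => // /sub es.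
  by rewrite -has_pred1 has_count in es.
have [||cs cycs pcs] := IH r.
- move: le_sm; rewrite (perm_size pr) size_cat; apply: leq_trans.
  by rewrite -[X in X < _]add0n ltn_add2r simple_cycle_neq0.
- by rewrite -(balanced_catr _ (balanced_simple_cycle cyc)) -(perm_balanced pr).
exists (c :: cs) => [d|]; first by rewrite inE => /predU1P[-> | /cycs].
by rewrite /= (perm_trans pr) // perm_cat2l.
Qed.

Lemma balanced_heavy_cycle p s : balanced s -> p * #|T| ^ 3 < size s ->
  exists2 c, simple_cycle c & forall e, e \in c -> p < count_mem e s.
Proof.
move=> bal big; have [cs cyc pcs] := cycle_decomposition bal.
pose light e := count_mem e s <= p.
have [/hasP[c ccs]|] := boolP (has (predC (has light)) cs).
  move=> /hasPn nl; exists c => [|e ec]; first exact: cyc.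
  by rewrite ltnNge; exact: nl.
rewrite has_predC negbK => /allP al; exfalso.
suff le_cs : size cs <= p * #|T| ^ 2.
  suff : size s <= p * #|T| ^ 3 by rewrite leqNgt big.
  have -> : p * #|T| ^ 3 = p * #|T| ^ 2 * #|T| by rewrite -mulnA -expnSr.
  apply: leq_trans (leq_mul le_cs (leqnn _)).
  rewrite (perm_size pcs); elim: cs cyc {al pcs le_cs} => //= c cs IH cyc.
  rewrite size_cat mulSn leq_add //; first by apply/simple_cycle_size/cyc; rewrite mem_head.
  by apply: IH => d dcs; apply: cyc; rewrite inE dcs orbT.
(* Each cycle uses up an occurrence of a light edge; at most [#|T| ^ 2] edges are light, each
   occurring at most [p] times. *)
apply: (@leq_trans (count light s)).
  rewrite (permP pcs); elim: cs al {cyc pcs} => //= c cs IH al.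
  rewrite count_cat -add1n leq_add //; first by rewrite -has_count al // mem_head.
  by apply: IH => d dcs; apply: al; rewrite inE dcs orbT.
have -> : count light s = \sum_(e | light e) count_mem e s.
  elim: (s) => [|a r IH] /=; first by rewrite big1.
  rewrite big_split /= -IH; congr (_ + _).
  rewrite (eq_bigr (fun e => if e == a then 1 else 0)) => [|e _]; last first.
    by rewrite eq_sym; case: eqP.
  rewrite -big_mkcondr (eq_bigl _ _ (fun e => andbC _ _)) big_mkcondr.
  by rewrite big_pred1_eq; case: ifP.
apply: (@leq_trans (\sum_(e | light e) p)); first by apply: leq_sum => e.
rewrite sum_nat_const mulnC leq_mul2l -mulnn -card_prod.
by rewrite max_card orbT.
Qed.

(* The skeleton is built by appending vertices: [a] ends at the last new vertex
   met so far, and [b] is the simple path followed since then. *)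
Lemma skeleton_walk x t : exists t0 s,
  [/\ last x t0 = last x t, {subset x :: t <= x :: t0}, balanced s,
      perm_eq (edges x t) (edges x t0 ++ s) & size t0 <= #|T| ^ 2].
Proof.
(* [a] grows by at most [#|T|] per new vertex, because the path [b] it absorbs is simple; the final
   [b] has fewer than [#|T|] edges. *)
suff [a [b [s [l sub bal pe [ub le_a]]]]] : exists a b s,
   [/\ last x (a ++ b) = last x t, x :: a =i x :: t, balanced s,
       perm_eq (edges x t) (edges x (a ++ b) ++ s)
     & uniq (last x a :: b) /\ size a <= #|T| * #|x :: t|.-1].
  exists (a ++ b), s; split=> //.
    by move=> z; rewrite -sub !inE mem_cat; case/orP=> ->; rewrite ?orbT.
  have le_b : size (last x a :: b) <= #|T| by rewrite -(card_uniqP ub) max_card.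
  have gt0 : 0 < #|x :: t| by apply/card_gt0P; exists x; rewrite mem_head.
  rewrite size_cat expnS expn1.
  have : #|T| * #|x :: t|.-1 + #|T| <= #|T| * #|T|.
    by rewrite addnC -mulnS prednK // leq_mul2l max_card orbT.
  by apply: leq_trans; rewrite leq_add // ltnW // (leq_trans _ le_b).
elim/last_ind: t => [|t y [a [b [s [l sub bal pe [ub le_a]]]]]].
  by exists [::], [::], [::]; split=> //.
have pe' : perm_eq (edges x (rcons t y)) (edges x (a ++ b ++ [:: y]) ++ s).
  rewrite -cats1 catA !edges_cat l.
  by rewrite (permPl (perm_cat pe (perm_refl _))) -!catA edges_cat -catA !perm_cat2l perm_catC.
have abt : x :: a ++ b =i x :: t.
  move=> z; apply/idP/idP; last by rewrite -sub -cat_cons mem_cat => ->.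
  rewrite !inE => /predU1P[-> | zab]; first by rewrite eqxx.
  have := perm_map snd pe; rewrite map_cat -!/(unzip2 _) !unzip2_edges => pt.
  by rewrite (perm_mem pt) mem_cat zab orbT.
have old : y \in x :: t -> x :: t =i x :: rcons t y.
  by rewrite -rcons_cons => yt z; rewrite mem_rcons [RHS]inE; case: eqP => // ->.
have [yab | nyab] := boolP (y \in last x a :: b).
  have yt : y \in x :: t.
    rewrite -abt -cat_cons mem_cat; move: yab; rewrite inE.
    by case/predU1P=> [-> | ->]; rewrite ?mem_last ?orbT.
  have {}old := old yt.
  case/splitPl: b / yab => b1 b2 xy in l pe ub pe' abt *.
  (* [y] is on the current path: the loop closed at [y] moves to [s]. *)
  exists a, b1, (edges y (b2 ++ [:: y]) ++ s); split.
  - by rewrite last_cat xy last_rcons.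
  - by move=> z; rewrite sub old.
  - by rewrite balanced_catr // balanced_closed // last_cat.
  - have e : a ++ (b1 ++ b2) ++ [:: y] = (a ++ b1) ++ b2 ++ [:: y] by rewrite -!catA.
    by rewrite catA; move: pe'; rewrite e (edges_cat _ (a ++ b1)) last_cat xy.
  - split; last by rewrite -(eq_card old).
    by move: ub; rewrite -cat_cons cat_uniq => /and3P[].
have [yt | nyt] := boolP (y \in x :: t).
  have {}old := old yt.
  (* [y] was visited before but is off the current path, which it extends. *)
  exists a, (rcons b y), s; split=> //.
  - by rewrite last_cat !last_rcons.
  - by move=> z; rewrite sub old.
  - by rewrite -(cats1 b).
  - split; last by rewrite -(eq_card old).
    by rewrite -rcons_cons rcons_uniq nyab.
(* [y] is new: the path joins [a] and restarts, empty, at [y]. *)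
exists (a ++ b ++ [:: y]), [::], s; split=> //.
- by rewrite cats0 !last_cat last_rcons.
- move=> z; rewrite catA cats1 -!rcons_cons !mem_rcons !inE.
  by have := abt z; rewrite !inE => ->.
- by rewrite cats0.
- split=> //; rewrite !size_cat /=.
  have -> : #|x :: rcons t y| = #|x :: t|.+1.
    rewrite -(eq_card (_ : [predU1 y & x :: t] =i x :: rcons t y)) ?cardU1 ?nyt //.
    by move=> z; rewrite -rcons_cons mem_rcons.
  have gt0 : 0 < #|x :: t| by apply/card_gt0P; exists x; rewrite mem_head.
  have le_b : size (last x a :: b) <= #|T| by rewrite -(card_uniqP ub) max_card.
  by rewrite addn1 -[#|x :: t|](prednK gt0) mulnS addnC leq_add.
Qed.

(** [m] gathers the skeleton and what [s] keeps after losing [p.+1] copies of a heavy cycle [c]. *)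
Lemma pumpable_walk p x t : p * #|T| ^ 3 + #|T| ^ 2 < size t ->
  exists m c : seq (T * T),
    [/\ 0 < size c, perm_eq (edges x t) (m ++ flatten (nseq p.+1 c))
      & forall j, j <= p -> exists2 t', last x t' = last x t
          & perm_eq (edges x t') (m ++ flatten (nseq j c))].
Proof.
move=> big; have [t0 [s [l0 sub bal pe le_t0]]] := skeleton_walk x t.
have big_s : p * #|T| ^ 3 < size s.
  rewrite -(ltn_add2r (#|T| ^ 2)) (leq_trans big) // -(size_edges x t).
  by rewrite (perm_size pe) size_cat size_edges addnC leq_add2l.
have [c cyc heavy] := balanced_heavy_cycle bal big_s.
have [e|r pr] := @count_mem_perm_cat _ (flatten (nseq p.+1 c)) s.
  rewrite count_flatten map_nseq sumn_nseq (count_uniq_mem _ (simple_cycle_uniq cyc)).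
  by case: (boolP (e \in c)) => // /heavy; rewrite mul1n.
have bal_c j : balanced (flatten (nseq j c)).
  by elim: j => //= j; rewrite balanced_catr // balanced_simple_cycle.
have bal_r : balanced r by rewrite -(balanced_catr _ (bal_c p.+1)) -(perm_balanced pr).
exists (edges x t0 ++ r), c; split; first exact: simple_cycle_neq0.
  by rewrite (perm_trans pe) // -catA perm_cat2l (perm_trans pr) // perm_catC.
move=> j _.
have [cs cycs pcs] : exists2 cs : seq (seq (T * T)),
    forall d, d \in cs -> simple_cycle d & perm_eq (r ++ flatten (nseq j c)) (flatten cs).
  by apply: cycle_decomposition; rewrite balanced_catr.
have [//|z|t' l' pt'] := @insert_cycles _ x t0 cs.
  (* Every edge to insert is an edge of the original walk, so its source lies on the skeleton. *)
  case/mapP=> e; rewrite -(perm_mem pcs) mem_cat => er ->; apply: sub.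
  have es : e \in s.
    rewrite (perm_mem pr) /= !mem_cat; case/orP: er => [->|]; first by rewrite orbT.
    by case/flattenP=> d; rewrite mem_nseq => /andP[_ /eqP->] ->.
  have : e \in edges x t by rewrite (perm_mem pe) mem_cat es orbT.
  by move/(map_f fst); rewrite -/(unzip1 _) unzip1_edges; apply: mem_belast.
exists t'; first by rewrite l'.
by rewrite (perm_trans pt') // -catA perm_cat2l perm_sym.
Qed.

End FiniteWalks.

(** * Naive iterates as sums over walks, and absorption by stability *)

Section Iteration.
Import GRing.Theory.
Local Open Scope ring_scope.
Context {S : comPzSemiRingType} {n : nat}.
Variables (A : 'M[S]_n) (b : 'cV[S]_n).
Implicit Types (s m c : seq ('I_n * 'I_n)) (t : seq 'I_n).

Definition weight s : S := \prod_(e <- s) A e.1 e.2.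

Lemma weight_cat s1 s2 : weight (s1 ++ s2) = weight s1 * weight s2.
Proof. exact: big_cat. Qed.

Lemma weight_nseq j c : weight (flatten (nseq j c)) = weight c ^+ j.
Proof.
by elim: j => [|j IH]; rewrite /= ?weight_cat ?IH ?exprS // /weight big_nil expr0.
Qed.

Lemma perm_weight s1 s2 : perm_eq s1 s2 -> weight s1 = weight s2.
Proof. exact: perm_big. Qed.

Lemma naive_iterateS q :
  naive_iterate A b q.+1 = naive_iterate A b q + iter q (mulmx A) b.
Proof.
elim: q => [|q IH]; first by rewrite /naive_iterate /= /linear_ico mulmx0 addrC.
rewrite [LHS]/naive_iterate iterS -/(naive_iterate A b q.+1) [LHS]/linear_ico [in LHS]IH.
by rewrite mulmxDr addrAC.
Qed.

(** Without an order on [S], being part of a sum is expressed by a remainder [r]. *)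
Lemma naive_iterate_lt a q i : (a < q)%N -> exists r,
  naive_iterate A b q i 0 = naive_iterate A b a i 0 + iter a (mulmx A) b i 0 + r.
Proof.
elim: q => // q IH; rewrite ltnS leq_eqVlt => /predU1P[-> | /IH[r er]].
  by exists 0; rewrite addr0 naive_iterateS mxE.
by exists (r + iter q (mulmx A) b i 0); rewrite naive_iterateS mxE er addrA.
Qed.

Lemma walk_summand i t : exists r,
  iter (size t) (mulmx A) b i 0 = weight (edges i t) * b (last i t) 0 + r.
Proof.
elim: t i => [|j t IH] i /=; first by exists 0; rewrite /weight big_nil mul1r addr0.
have [r er] := IH j; rewrite mxE (bigD1 j) //= er mulrDr mulrA -addrA.
by rewrite {2}/weight big_cons; eexists.
Qed.

(** Elements absorbed by [X] are closed under addition, so single walks suffice; [a] carries the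
    weight of the prefix already walked. *)
Lemma absorb_walks (X a : S) k i :
  (forall t, size t = k -> X + a * weight (edges i t) * b (last i t) 0 = X) ->
  X + a * iter k (mulmx A) b i 0 = X.
Proof.
elim: k a i => [|k IH] a i abs.
  by have := abs [::] erefl; rewrite /weight big_nil mulr1.
rewrite /= mxE big_distrr /=; elim/big_ind: _ => [|y z Xy Xz|j _].
- by rewrite addr0.
- by rewrite addrA Xy Xz.
- rewrite mulrA; apply: IH => t tk; have := abs (j :: t); rewrite /= tk => /(_ erefl).
  by rewrite /weight big_cons !mulrA.
Qed.

(** Since [c] is nonempty, different [j] give walks of different lengths. Their summands sit in
    different powers of [A], so they occur together in one iterate even though addition need not be
    idempotent. *)
Lemma pumped_summands p i l m c : (0 < size c)%N ->
  (forall j, (j <= p)%N -> exists2 t, last i t = l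
     & perm_eq (edges i t) (m ++ flatten (nseq j c))) ->
  exists r, naive_iterate A b (size m + p.+1 * size c) i 0
            = weight m * power_sum (weight c) p * b l 0 + r.
Proof.
move=> c0 pump; rewrite /power_sum; have : (p.+1 <= p.+1)%N by [].
(* The first [j] terms of the power sum come from walks shorter than [size m + j * size c]. *)
elim: {-2}p.+1 => [|j IH] lt_jp.
  by eexists; rewrite big_ord0 mulr0 mul0r add0r.
have [r er] := IH (ltnW lt_jp); have [t tl pt] := pump j lt_jp.
have st : size t = (size m + j * size c)%N.
  by rewrite -(size_edges i) (perm_size pt) size_cat size_flatten_nseq.
have [|r' er'] := @naive_iterate_lt (size t) (size m + j.+1 * size c) i.
  by rewrite st ltn_add2l ltn_pmul2r.
have [r'' er''] := walk_summand i t.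
rewrite er' er'' {1}st er (perm_weight pt) weight_cat weight_nseq tl.
rewrite big_ord_recr /= mulrDr mulrDl.
exists (r + r'' + r'); rewrite -!addrA; congr (_ + _).
by rewrite [r + _]addrCA.
Qed.

Lemma naive_iterate_stable p q : stable_semiring S p ->
  (p * n ^ 3 + n ^ 2 < q)%N -> naive_iterate A b q.+1 = naive_iterate A b q.
Proof.
move=> stab lt_q; rewrite naive_iterateS; apply/colP=> i; rewrite mxE.
rewrite -[X in _ + X]mul1r; apply: absorb_walks => t tq; rewrite mul1r.
have [|m [c [c0 pe pump]]] := @pumpable_walk _ p i t; first by rewrite card_ord tq.
have [r er] := pumped_summands c0 pump.
have q_eq : q = (size m + p.+1 * size c)%N.
  by rewrite -tq -(size_edges i) (perm_size pe) size_cat size_flatten_nseq.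
(* Stability of the cycle weight, read as absorption of its next power. *)
have abs : power_sum (weight c) p + weight c ^+ p.+1 = power_sum (weight c) p.
  by rewrite [RHS](stab (weight c)) /power_sum [RHS]big_ord_recr.
by rewrite {}q_eq er addrAC (perm_weight pe) weight_cat weight_nseq -mulrDl -mulrDr abs.
Qed.

End Iteration.

Theorem theorem5 :
  exists2 C : nat, 0 < C &
    forall (n p : nat), 1 <= n -> 1 <= p ->
    forall S : comPzSemiRingType, stable_semiring S p ->
    forall (A : 'M[S]_n) (b : 'cV[S]_n),
    exists2 q : nat, q <= C * p * n ^ 3 &
      naive_iterate A b q.+1 = naive_iterate A b q.
Proof.
(* The three summands of [p * n ^ 3 + n ^ 2 + 1] are each at most [p * n ^ 3]. *)
exists 3 => // n p n0 p0 S stab A b.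
exists (p * n ^ 3 + n ^ 2).+1; last exact: naive_iterate_stable stab _.
have le2 : n ^ 2 <= p * n ^ 3 by rewrite expnS mulnA leq_pmull // muln_gt0 p0.
have le1 : 0 < p * n ^ 3 by rewrite muln_gt0 p0 expn_gt0 n0.
by rewrite -mulnA !mulSn mul0n addn0 -addnS leq_add2l -addn1 leq_add.
Qed.
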